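(* Let $A\in\mathbb{R}^{n\times n}$ be a nonsingular matrix, $b\in\mathbb{R}^n$, $\nu=\|A^{-1}\|_2$, and let $\omega$ be a real number. Suppose that one of the following conditions holds: (i) $\nu\in(0,\tfrac{\sqrt2}{2})$ and $\omega_1(\nu)<\omega<\omega_2(\nu)$; (ii) $\nu\in(\tfrac{\sqrt2}{2},1)$ and $\omega_3(\nu)<\omega<\omega_4(\nu)$; (iii) $\nu=\tfrac{\sqrt2}{2}$ and $\omega_5<\omega<\omega_6$; where $\omega_1(\nu),\dots,\omega_4(\nu),\omega_5,\omega_6$ are the explicit quantities given in the context. Let $(x^{(k)},y^{(k)})_{k\ge0}$ be the sequence generated from arbitrary $x^{(0)},y^{(0)}\in\mathbb{R}^n$ by the SOR-like iteration $$x^{(k+1)}=(1-\omega)x^{(k)}+\omega A^{-1}(y^{(k)}+b),\qquad y^{(k+1)}=(1-\omega)y^{(k)}+\omega|x^{(k+1)}|,$$ and let $e_k^x=x^*-x^{(k)}$, $e_k^y=y^*-y^{(k)}$, where $x^*$ is the unique solution of $Ax-|x|-b=0$ and $y^*=|x^*|$. Then for all $k=0,1,2,\dots$ $$\||(e_{k+1}^x,e_{k+1}^y)|\|_\omega\le\|T_\nu(\omega)\|_2\cdot\||(e_k^x,e_k^y)|\|_\omega\quad\text{with}\quad\|T_\nu(\omega)\|_2<1,$$ and consequently the sequence $\{x^{(k)}\}$ converges to the unique solution $x^*$ of $Ax-|x|-b=0$.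
   Context: For $x\in\mathbb{R}^n$, $|x|$ denotes the componentwise absolute value; $\|\cdot\|_2$ is the Euclidean norm on vectors and the spectral norm on matrices. It is known that if $\|A^{-1}\|_2<1$ then the absolute value equation $Ax-|x|-b=0$ has a unique solution $x^*$ for every $b\in\mathbb{R}^n$. For $\omega>0$ the norm on pairs of vectors is $\||(u,v)|\|_\omega=\sqrt{\|u\|_2^2+\omega^{-2}\|v\|_2^2}$. The matrix $T_\nu(\omega)$ is $$T_\nu(\omega)=\begin{pmatrix}|1-\omega| & \omega^2\nu\\ |1-\omega| & |1-\omega|+\omega^2\nu\end{pmatrix}.$$ Put $\alpha=4-2\nu$, $\beta=2\nu^2-1$, $\xi=4+2\nu$, $\gamma=\sqrt{-(\nu-1)(\nu+5)}$, $\zeta=\sqrt{-(\nu+1)(\nu-5)}$. For $0<\nu<\frac{\sqrt2}{2}$ define $$\omega_1(\nu)=-\frac{\alpha}{4\beta}+\frac{\gamma}{2\beta}-\frac{\sqrt{-(8\nu^3-16\nu^2+4\nu-1)-(8\nu^2-2\nu)\gamma}}{2\beta},$$ $$\omega_2(\nu)=-\frac{\xi}{4\beta}-\frac{\zeta}{2\beta}+\frac{\sqrt{(8\nu^3+16\nu^2+4\nu+1)+(8\nu^2+2\nu)\zeta}}{2\beta}.$$ For $\frac{\sqrt2}{2}<\nu<1$ define $$\omega_3(\nu)=-\frac{\alpha}{4\beta}+\frac{\gamma}{2\beta}+\frac{\sqrt{-(8\nu^3-16\nu^2+4\nu-1)-(8\nu^2-2\nu)\gamma}}{2\beta},$$ $$\omega_4(\nu)=-\frac{\alpha}{4\beta}-\frac{\gamma}{2\beta}+\frac{\sqrt{-(8\nu^3-16\nu^2+4\nu-1)+(8\nu^2-2\nu)\gamma}}{2\beta}.$$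 Finally $$\omega_5=-\frac17-\frac{\sqrt2}{28}+\frac{\sqrt{242+64\sqrt2}}{28},\qquad \omega_6=1.$$ (These are the roots in $(0,2)$ of $f_\nu(\omega)=3(\omega-1)^2+2\nu^2\omega^4+2\nu\omega^2|\omega-1|-(\omega-1)^4-1$ for the respective values of $\nu$.) *)

(* Defs.v *)
From HB Require Import structures.
From mathcomp Require Import all_boot all_order all_algebra.
From mathcomp Require Import all_classical all_reals all_analysis.

Set Implicit Arguments.
Unset Strict Implicit.
Unset Printing Implicit Defensive.

Import Order.TTheory GRing.Theory Num.Theory.
Import numFieldNormedType.Exports.

Local Open Scope classical_set_scope.
Local Open Scope ring_scope.

(* MathComp-Analysis equips matrices with the max norm, so the Euclidean and
   spectral norms are defined here; [`|v|] on a vector is never used below. *)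
Definition norm2 (R : realType) (n : nat) (v : 'cV[R]_n) : R :=
  Num.sqrt (\sum_(i < n) v i 0 ^+ 2).

(* The unit ball rather than the unit sphere keeps the set nonempty for n = 0. *)
Definition spectral_norm (R : realType) (m n : nat) (M : 'M[R]_(m, n)) : R :=
  sup [set norm2 (M *m v) | v in [set v : 'cV[R]_n | norm2 v <= 1]].

Definition absv (R : realType) (n : nat) (v : 'cV[R]_n) : 'cV[R]_n :=
  map_mx (fun t : R => `|t|) v.

Definition AVE_solution (R : realType) (n : nat) (A : 'M[R]_n) (b : 'cV[R]_n)
    (x : 'cV[R]_n) : Prop :=
  A *m x - absv x - b = 0.

Definition pair_norm (R : realType) (n : nat) (omega : R) (u v : 'cV[R]_n) : R :=
  Num.sqrt (norm2 u ^+ 2 + omega ^- 2 * norm2 v ^+ 2).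

Definition T_mx (R : realType) (nu omega : R) : 'M[R]_2 :=
  block_mx (`|1 - omega|%:M : 'M[R]_1) ((omega ^+ 2 * nu)%:M : 'M[R]_1)
           (`|1 - omega|%:M : 'M[R]_1) ((`|1 - omega| + omega ^+ 2 * nu)%:M : 'M[R]_1).

Definition SOR_like (R : realType) (n : nat) (A : 'M[R]_n) (b : 'cV[R]_n)
    (omega : R) (x y : nat -> 'cV[R]_n) : Prop :=
  forall k : nat,
    x k.+1 = (1 - omega) *: x k + omega *: (invmx A *m (y k + b)) /\
    y k.+1 = (1 - omega) *: y k + omega *: absv (x k.+1).

Definition alpha (R : realType) (nu : R) : R := 4 - 2 * nu.
Definition beta (R : realType) (nu : R) : R := 2 * nu ^+ 2 - 1.
Definition xi (R : realType) (nu : R) : R := 4 + 2 * nu.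
Definition gamma (R : realType) (nu : R) : R :=
  Num.sqrt (- (nu - 1) * (nu + 5)).
Definition zeta (R : realType) (nu : R) : R :=
  Num.sqrt (- (nu + 1) * (nu - 5)).

(* Every radicand is nonnegative for the values of nu at which the theorem uses
   it, so the convention Num.sqrt t = 0 for t < 0 plays no role. *)
Definition omega1 (R : realType) (nu : R) : R :=
  - (alpha nu / (4 * beta nu)) + gamma nu / (2 * beta nu)
  - Num.sqrt (- (8 * nu ^+ 3 - 16 * nu ^+ 2 + 4 * nu - 1)
              - (8 * nu ^+ 2 - 2 * nu) * gamma nu) / (2 * beta nu).

Definition omega2 (R : realType) (nu : R) : R :=
  - (xi nu / (4 * beta nu)) - zeta nu / (2 * beta nu)
  + Num.sqrt ((8 * nu ^+ 3 + 16 * nu ^+ 2 + 4 * nu + 1)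
              + (8 * nu ^+ 2 + 2 * nu) * zeta nu) / (2 * beta nu).

Definition omega3 (R : realType) (nu : R) : R :=
  - (alpha nu / (4 * beta nu)) + gamma nu / (2 * beta nu)
  + Num.sqrt (- (8 * nu ^+ 3 - 16 * nu ^+ 2 + 4 * nu - 1)
              - (8 * nu ^+ 2 - 2 * nu) * gamma nu) / (2 * beta nu).

Definition omega4 (R : realType) (nu : R) : R :=
  - (alpha nu / (4 * beta nu)) - gamma nu / (2 * beta nu)
  + Num.sqrt (- (8 * nu ^+ 3 - 16 * nu ^+ 2 + 4 * nu - 1)
              + (8 * nu ^+ 2 - 2 * nu) * gamma nu) / (2 * beta nu).

Definition omega5 (R : realType) : R :=
  - (1 / 7) - Num.sqrt 2 / 28 + Num.sqrt (242 + 64 * Num.sqrt 2) / 28.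

Definition omega6 (R : realType) : R := 1.

(* Main.v *)
Require Import Defs.
From HB Require Import structures.
From mathcomp Require Import all_boot all_order all_algebra.
From mathcomp Require Import all_classical all_reals all_analysis.
From mathcomp Require Import ring lra.

Set Implicit Arguments.
Unset Strict Implicit.
Unset Printing Implicit Defensive.

Import Order.TTheory GRing.Theory Num.Theory.
Import numFieldNormedType.Exports.

Local Open Scope classical_set_scope.
Local Open Scope ring_scope.

(** One sweep of the iteration acts on the pair (norm of the x-error, norm of
    the y-error divided by [omega]) at most like the 2 x 2 matrix
    [T = T_mx nu omega], because [absv] is 1-Lipschitz ([norm2_absvB]) and
    [invmx A] stretches by at most [nu]; this is [SOR_error_step].  So the
    theorem reduces to showing that the norm of [T] is below 1.

    The norm is below 1 as soon as both eigenvalues of [T^T * T] are.  Their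
    product is [(1 - omega) ^+ 4], which is below 1 for [0 < omega < 2], and
    then the condition becomes that the characteristic polynomial of [T^T * T]
    is positive at 1, that is [sor_poly nu omega < 0] ([T_mx_norm_lt1]).

    The quartic factors explicitly.  For [omega <= 1] it equals
    [(r * omega ^+ 2 + omega - 1) * (s * omega ^+ 2 + omega - 1)] with
    [r, s = 2 - nu -+ gamma nu] ([sor_poly_le1]); for [omega >= 1] the same
    holds with [nu] replaced by [- nu], which turns [gamma] into [zeta]
    ([sor_poly_ge1]).  Moreover [r * s = beta nu] in both cases, so that, up to
    a common factor [r] or [s] in numerator and denominator, the endpoints are
    the roots [(sqrt (1 + 4 * s) - 1) / (2 * s)] of these quadratic factors
    ([omega1E] to [omega5E]).  Between them exactly one factor is negative
    ([omega_range]).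

    Since the range conditions force [nu < 1], the map
    [v |-> A^-1 (|v| + b)] is a Euclidean contraction, so the equation has
    exactly one solution ([AVE_unique_solution]), and the error bound then
    makes the errors decay geometrically. *)

(** * Euclidean and spectral norms *)

Lemma norm2_sqr (R : realType) (n : nat) (v : 'cV[R]_n) :
  norm2 v ^+ 2 = \sum_(i < n) v i 0 ^+ 2.
Proof. by rewrite sqr_sqrtr // sumr_ge0 // => i _; rewrite sqr_ge0. Qed.

Lemma norm2_ge0 (R : realType) (n : nat) (v : 'cV[R]_n) : 0 <= norm2 v.
Proof. exact: sqrtr_ge0. Qed.

Lemma norm20 (R : realType) (n : nat) : norm2 (0 : 'cV[R]_n) = 0.
Proof. by rewrite /norm2 big1 ?sqrtr0 // => i _; rewrite mxE expr0n. Qed.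

Lemma norm2_eq0 (R : realType) (n : nat) (v : 'cV[R]_n) :
  norm2 v = 0 -> v = 0.
Proof.
move=> v0; have /eqP := norm2_sqr v; rewrite v0 expr0n eq_sym /=.
rewrite psumr_eq0 => [/allP vi0|i _]; last exact: sqr_ge0.
apply/colP => i; rewrite mxE; apply/eqP.
by rewrite -sqrf_eq0 (eqP (vi0 i (mem_index_enum i))).
Qed.

Lemma norm2Z (R : realType) (n : nat) (c : R) (v : 'cV[R]_n) :
  norm2 (c *: v) = `|c| * norm2 v.
Proof.
rewrite /norm2 (eq_bigr (fun i => c ^+ 2 * v i 0 ^+ 2)); last first.
  by move=> i _; rewrite mxE exprMn.
by rewrite -mulr_sumr sqrtrM ?sqr_ge0 // sqrtr_sqr.
Qed.

Lemma norm2_mono (R : realType) (n : nat) (u v : 'cV[R]_n) :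
  (forall i, `|u i 0| <= `|v i 0|) -> norm2 u <= norm2 v.
Proof.
move=> uv; rewrite ler_sqrt; last first.
  by rewrite sumr_ge0 // => i _; rewrite sqr_ge0.
apply: ler_sum => i _; rewrite -[leLHS]real_normK ?num_real //.
by rewrite -[leRHS]real_normK ?num_real // ler_pXn2r ?nnegrE.
Qed.

Lemma norm2_entry (R : realType) (n : nat) (v : 'cV[R]_n) (i : 'I_n) :
  `|v i 0| <= norm2 v.
Proof.
rewrite -(@ler_pXn2r _ 2) ?nnegrE ?norm2_ge0 // norm2_sqr.
rewrite real_normK ?num_real //.
by rewrite (bigD1 i) //= lerDl sumr_ge0 // => j _; rewrite sqr_ge0.
Qed.

(** Here [`|v|] is the maximum norm, in which convergence and completeness of
    ['cV[R]_n] are expressed; it is equivalent to the Euclidean norm. *)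
Lemma norm_le_norm2 (R : realType) (n : nat) (v : 'cV[R]_n) : `|v| <= norm2 v.
Proof.
rewrite /Num.norm /= mx_normrE.
elim/big_ind : _ => [|a c ha hc|[i j] _ /=]; first exact: norm2_ge0.
  by rewrite ge_max ha hc.
by rewrite ord1 norm2_entry.
Qed.

Lemma norm2_le_norm (R : realType) (n : nat) (v : 'cV[R]_n) :
  norm2 v <= Num.sqrt n%:R * `|v|.
Proof.
rewrite -[X in _ * X]ger0_norm // -sqrtr_sqr -sqrtrM ?ler0n //.
rewrite ler_sqrt ?mulr_ge0 ?ler0n ?sqr_ge0 //.
rewrite mulr_natl -[X in _ *+ X]card_ord -sumr_const; apply: ler_sum => i _.
rewrite -real_normK ?num_real // ler_pXn2r ?nnegrE //.
rewrite [leRHS]/Num.norm /= mx_normrE.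
exact: (le_bigmax _ (fun ij : 'I_n * 'I_1 => `|v ij.1 ij.2|) (i, 0)).
Qed.

(** The sum of the squares [(q u_i - p v_i) ^+ 2], with [p] and [q] the norms
    of [u] and [v], is [2 p q (p q - <u, v>)]; as it is
    nonnegative, the inequality follows when [p q > 0]. *)
Lemma norm2_CauchySchwarz (R : realType) (n : nat) (u v : 'cV[R]_n) :
  \sum_(i < n) u i 0 * v i 0 <= norm2 u * norm2 v.
Proof.
set p := norm2 u; set q := norm2 v.
have [p0|p0] := eqVneq p 0.
  rewrite p0 mul0r big1 // => i _.
  by rewrite (norm2_eq0 p0) mxE mul0r.
have [q0|q0] := eqVneq q 0.
  rewrite q0 mulr0 big1 // => i _.
  by rewrite (norm2_eq0 q0) mxE mulr0.
have pq_gt0 : 0 < p * q by rewrite mulr_gt0 // lt0r norm2_ge0 ?p0 ?q0.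
have : 0 <= \sum_(i < n) (q * u i 0 - p * v i 0) ^+ 2.
  by rewrite sumr_ge0 // => i _; rewrite sqr_ge0.
rewrite (eq_bigr (fun i => q ^+ 2 * u i 0 ^+ 2 + (p ^+ 2 * v i 0 ^+ 2
   + (- (2 * p * q)) * (u i 0 * v i 0)))); last by move=> i _; ring.
rewrite !big_split /= -!mulr_sumr -!norm2_sqr -/p -/q => h.
by rewrite -(ler_pM2l pq_gt0); lra.
Qed.

Lemma norm2D (R : realType) (n : nat) (u v : 'cV[R]_n) :
  norm2 (u + v) <= norm2 u + norm2 v.
Proof.
rewrite -(@ler_pXn2r _ 2) ?nnegrE ?addr_ge0 ?norm2_ge0 //.
rewrite sqrrD !norm2_sqr (eq_bigr (fun i => u i 0 ^+ 2 + (v i 0 ^+ 2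
   + 2 * (u i 0 * v i 0)))); last by move=> i _; rewrite mxE; ring.
rewrite !big_split /= -mulr_sumr -!norm2_sqr.
by have := norm2_CauchySchwarz u v; lra.
Qed.

(** Reverse triangle inequality, entry by entry: the nonlinearity [absv]
    costs nothing in any of the error bounds. *)
Lemma norm2_absvB (R : realType) (n : nat) (u v : 'cV[R]_n) :
  norm2 (absv u - absv v) <= norm2 (u - v).
Proof. by apply: norm2_mono => i; rewrite !mxE; exact: ler_dist_dist. Qed.

(** On the unit ball every coordinate is at most 1 in absolute value, so the
    vector of absolute row sums dominates all images. *)
Lemma spectral_norm_has_sup (R : realType) (m n : nat) (M : 'M[R]_(m, n)) :
  has_sup [set norm2 (M *m v) | v in [set v : 'cV[R]_n | norm2 v <= 1]].
Proof.
split; first by exists (norm2 (M *m 0)), 0 => //=; rewrite norm20.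
exists (norm2 (\col_i \sum_j `|M i j|)) => _ [v /= v1 <-].
apply: norm2_mono => i; rewrite !mxE [leRHS]ger0_norm; last by rewrite sumr_ge0.
apply: le_trans (ler_norm_sum _ _ _) _; apply: ler_sum => j _.
by rewrite normrM ler_piMr // (le_trans (norm2_entry _ _)).
Qed.

Lemma norm2_mulmx (R : realType) (m n : nat) (M : 'M[R]_(m, n)) (v : 'cV[R]_n) :
  norm2 (M *m v) <= spectral_norm M * norm2 v.
Proof.
have [v0|v0] := eqVneq (norm2 v) 0.
  by rewrite (norm2_eq0 v0) mulmx0 !norm20 mulr0.
have v_gt0 : 0 < norm2 v by rewrite lt0r v0 norm2_ge0.
rewrite -ler_pdivrMr // mulrC -[X in X * _]ger0_norm ?invr_ge0 ?norm2_ge0 //.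
rewrite -norm2Z scalemxAr; apply: ub_le_sup.
  by case: (spectral_norm_has_sup M).
exists ((norm2 v)^-1 *: v) => //=.
by rewrite norm2Z ger0_norm ?invr_ge0 ?norm2_ge0 // mulVf.
Qed.

Lemma spectral_norm_ge0 (R : realType) (m n : nat) (M : 'M[R]_(m, n)) :
  0 <= spectral_norm M.
Proof.
apply: le_trans (norm2_ge0 (M *m 0)) _.
apply: ub_le_sup; first by case: (spectral_norm_has_sup M).
by exists 0 => //=; rewrite norm20.
Qed.

Lemma spectral_norm_le (R : realType) (m n : nat) (M : 'M[R]_(m, n)) (t : R) :
  0 <= t -> (forall v, norm2 (M *m v) <= t * norm2 v) -> spectral_norm M <= t.
Proof.
move=> t0 Mt; apply: ge_sup; first by case: (spectral_norm_has_sup M).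
move=> _ [v /= v1 <-]; apply: le_trans (Mt v) _.
by rewrite ler_piMr.
Qed.

(** * The range of relaxation parameters *)

(** With [S] the square root of the discriminant, the bound on [w] reads
    [S < 2 * r * w + 1], and the square of the right-hand side is
    [1 + 4 * r + 4 * r * (r * w ^+ 2 + w - 1)].  A negative discriminant makes
    [S = 0], and squaring still gives the sign of the quadratic.  Were [w >= 2],
    one would get [S < 1 + 4 * r < 1] and hence [S ^+ 2 <= S < 1 + 4 * r],
    whereas [1 + 4 * r <= S ^+ 2]. *)
Lemma quad_lt0_neg (R : realType) (r w : R) :
  r < 0 -> w < (Num.sqrt (1 + 4 * r) - 1) / (2 * r) ->
  r * w ^+ 2 + w - 1 < 0 /\ w < 2.
Proof.
move=> r0; set S := Num.sqrt _ => hw.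
have S0 : 0 <= S by exact: sqrtr_ge0.
have S2 : 1 + 4 * r <= S ^+ 2.
  rewrite /S; have [h|h] := leP 0 (1 + 4 * r); first by rewrite sqr_sqrtr.
  by rewrite (le_trans (ltW h)) // sqr_ge0.
have {}hw : S < 2 * r * w + 1.
  by move: hw; rewrite ltr_ndivlMr; [lra|lra].
have h : S ^+ 2 < (2 * r * w + 1) ^+ 2 by rewrite ltr_pXn2r // nnegrE; lra.
split; first by rewrite -(nmulr_rgt0 _ r0); lra.
rewrite ltNge; apply/negP => w2.
have rw : r * w <= r * 2 by rewrite ler_nM2l.
have SS : S < 1 + 4 * r by lra.
have : 0 <= S * (1 - S) by rewrite mulr_ge0 //; lra.
by lra.
Qed.

Lemma quad_lt0_pos (R : realType) (r w : R) :
  0 < r -> 0 < w -> w < (Num.sqrt (1 + 4 * r) - 1) / (2 * r) ->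
  r * w ^+ 2 + w - 1 < 0.
Proof.
move=> r0 w0; rewrite ltr_pdivlMr; last lra.
move=> hw; have rw : 0 < r * w by rewrite mulr_gt0.
have : (2 * r * w + 1) ^+ 2 < Num.sqrt (1 + 4 * r) ^+ 2.
  by rewrite ltr_pXn2r // ?nnegrE ?sqrtr_ge0 //; lra.
rewrite sqr_sqrtr; last lra.
by move=> h; rewrite -(pmulr_rlt0 _ r0); lra.
Qed.

Lemma quad_gt0_pos (R : realType) (s w : R) :
  0 < s -> (Num.sqrt (1 + 4 * s) - 1) / (2 * s) < w ->
  0 < w /\ 0 < s * w ^+ 2 + w - 1.
Proof.
move=> s0; rewrite ltr_pdivrMr; last lra.
have S1 : 1 < Num.sqrt (1 + 4 * s) by rewrite -{1}sqrtr1 ltr_sqrt; lra.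
move=> hw; split; first by rewrite -(pmulr_rgt0 _ s0); lra.
have : Num.sqrt (1 + 4 * s) ^+ 2 < (2 * s * w + 1) ^+ 2.
  by rewrite ltr_pXn2r // ?nnegrE ?sqrtr_ge0 //; lra.
rewrite sqr_sqrtr; last lra.
by move=> h; rewrite -(pmulr_rgt0 _ s0); lra.
Qed.

Lemma gamma_sqr (R : realType) (nu : R) :
  0 < nu < 1 -> gamma nu ^+ 2 = 5 - 4 * nu - nu ^+ 2.
Proof.
move=> /andP[nu0 nu1]; rewrite sqr_sqrtr; first by ring.
by rewrite mulr_ge0; lra.
Qed.

Lemma zeta_sqr (R : realType) (nu : R) :
  0 < nu < 1 -> zeta nu ^+ 2 = 5 + 4 * nu - nu ^+ 2.
Proof.
move=> /andP[nu0 nu1]; rewrite sqr_sqrtr; first by ring.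
have -> : - (nu + 1) * (nu - 5) = (1 + nu) * (5 - nu) by ring.
by rewrite mulr_ge0; lra.
Qed.

(** Expanding a root of [s * w ^+ 2 + w - 1] by [r] gives the denominator
    [2 * beta nu] under which the endpoints [omega1] to [omega4] are written. *)
Lemma root_rescale (R : realType) (r s be : R) :
  r != 0 -> s != 0 -> r * s = be ->
  - r / (2 * be) + r * Num.sqrt (1 + 4 * s) / (2 * be)
  = (Num.sqrt (1 + 4 * s) - 1) / (2 * s).
Proof. by move=> r0 s0 <-; field; rewrite r0 s0. Qed.

Lemma sqrt_discr (R : realType) (r s : R) :
  Num.sqrt (r ^+ 2 * (1 + 4 * s)) = `|r| * Num.sqrt (1 + 4 * s).
Proof. by rewrite sqrtrM ?sqr_ge0 // sqrtr_sqr. Qed.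

Section Roots.
Context (R : realType) (nu : R) (nu01 : 0 < nu < 1).

Let r := 2 - nu - gamma nu.
Let s := 2 - nu + gamma nu.
Let r' := 2 + nu - zeta nu.
Let s' := 2 + nu + zeta nu.

Lemma gamma_root_gt0 : 0 < s.
Proof.
have g0 : 0 <= gamma nu by exact: sqrtr_ge0.
by have [nu0 nu1] := andP nu01; rewrite /s; lra.
Qed.

Lemma zeta_root_gt0 : 0 < s'.
Proof.
have g0 : 0 <= zeta nu by exact: sqrtr_ge0.
by have [nu0 nu1] := andP nu01; rewrite /s'; lra.
Qed.

Lemma gamma_roots_mul : r * s = beta nu.
Proof. by rewrite /beta /r /s; ring: (gamma_sqr nu01). Qed.

Lemma zeta_roots_mul : r' * s' = beta nu.
Proof. by rewrite /beta /r' /s'; ring: (zeta_sqr nu01). Qed.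

(** The radicand is [r ^+ 2] times the discriminant of [s * w ^+ 2 + w - 1]; as
    [r < 0] here, the minus sign in [omega1] is undone by [`|r| = - r].  In
    [omega3] neither sign occurs. *)
Lemma omega1E : beta nu < 0 ->
  omega1 nu = (Num.sqrt (1 + 4 * s) - 1) / (2 * s).
Proof.
move=> be0; have r0 : r < 0.
  by rewrite -(pmulr_llt0 _ gamma_root_gt0) gamma_roots_mul.
have sN0 := lt0r_neq0 gamma_root_gt0.
rewrite -(root_rescale (ltr0_neq0 r0) sN0 gamma_roots_mul).
rewrite /omega1 (_ : _ - (8 * _ - _) * _ = r ^+ 2 * (1 + 4 * s)); last first.
  by rewrite /r /s; ring: (gamma_sqr nu01).
rewrite sqrt_discr ltr0_norm // /alpha /r.
by field; rewrite ltr0_neq0.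
Qed.

Lemma omega3E : 0 < beta nu ->
  omega3 nu = (Num.sqrt (1 + 4 * s) - 1) / (2 * s).
Proof.
move=> be0; have r0 : 0 < r.
  by rewrite -(pmulr_lgt0 _ gamma_root_gt0) gamma_roots_mul.
have sN0 := lt0r_neq0 gamma_root_gt0.
rewrite -(root_rescale (lt0r_neq0 r0) sN0 gamma_roots_mul).
rewrite /omega3 (_ : _ - (8 * _ - _) * _ = r ^+ 2 * (1 + 4 * s)); last first.
  by rewrite /r /s; ring: (gamma_sqr nu01).
rewrite sqrt_discr gtr0_norm // /alpha /r.
by field; rewrite lt0r_neq0.
Qed.

Lemma omega4E : 0 < beta nu ->
  omega4 nu = (Num.sqrt (1 + 4 * r) - 1) / (2 * r).
Proof.
move=> be0; have r0 : 0 < r.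
  by rewrite -(pmulr_lgt0 _ gamma_root_gt0) gamma_roots_mul.
have sr : s * r = beta nu by rewrite mulrC gamma_roots_mul.
rewrite -(root_rescale (lt0r_neq0 gamma_root_gt0) (lt0r_neq0 r0) sr).
rewrite /omega4 (_ : _ + (8 * _ - _) * _ = s ^+ 2 * (1 + 4 * r)); last first.
  by rewrite /r /s; ring: (gamma_sqr nu01).
rewrite sqrt_discr gtr0_norm ?gamma_root_gt0 // /alpha /s.
by field; rewrite lt0r_neq0.
Qed.

Lemma omega2E : beta nu < 0 ->
  omega2 nu = (Num.sqrt (1 + 4 * r') - 1) / (2 * r').
Proof.
move=> be0; have r0 : r' < 0.
  by rewrite -(pmulr_llt0 _ zeta_root_gt0) zeta_roots_mul.
have sr : s' * r' = beta nu by rewrite mulrC zeta_roots_mul.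
rewrite -(root_rescale (lt0r_neq0 zeta_root_gt0) (ltr0_neq0 r0) sr).
rewrite /omega2 (_ : _ + (8 * _ + _) * _ = s' ^+ 2 * (1 + 4 * r')); last first.
  by rewrite /r' /s'; ring: (zeta_sqr nu01).
rewrite sqrt_discr gtr0_norm ?zeta_root_gt0 // /xi /s'.
by field; rewrite ltr0_neq0.
Qed.

End Roots.

(** Since [\tr (T^T * T) = 3 a^2 + 2 a c + 2 c^2] and [\det T = a^2] for
    [a = `|w - 1|] and [c = w^2 nu], this is minus the characteristic polynomial
    of [T^T * T] at 1. *)
Definition sor_poly (R : realType) (nu w : R) : R :=
  3 * (w - 1) ^+ 2 + 2 * nu ^+ 2 * w ^+ 4 + 2 * nu * w ^+ 2 * `|w - 1|
  - (w - 1) ^+ 4 - 1.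

(** With [a = 1 - w >= 0], the identity
    [3 a^2 - a^4 - 1 = a^2 - 4 a w^2 - w^4] leaves
    [(2 nu^2 - 1) w^4 - (4 - 2 nu) a w^2 + a^2], a quadratic form in [w^2] and
    [a].  Factoring the form instead of the quartic also covers
    [2 nu^2 = 1], where the quartic loses its leading term. *)
Lemma sor_poly_le1 (R : realType) (nu w : R) : 0 < nu < 1 -> w <= 1 ->
  sor_poly nu w = ((2 - nu - gamma nu) * w ^+ 2 + w - 1)
           * ((2 - nu + gamma nu) * w ^+ 2 + w - 1).
Proof.
move=> nu01 w1; rewrite /sor_poly ler0_norm; last lra.
by ring: (gamma_sqr nu01).
Qed.

(** This is [sor_poly_le1] with [nu] replaced by [- nu], since the absolute
    value enters only through [nu * `|w - 1|]. *)
Lemma sor_poly_ge1 (R : realType) (nu w : R) : 0 < nu < 1 -> 1 <= w ->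
  sor_poly nu w = ((2 + nu - zeta nu) * w ^+ 2 + w - 1)
           * ((2 + nu + zeta nu) * w ^+ 2 + w - 1).
Proof.
move=> nu01 w1; rewrite /sor_poly ger0_norm; last lra.
by ring: (zeta_sqr nu01).
Qed.

Lemma omega5E (R : realType) (s : R := 4 - Num.sqrt 2) :
  omega5 R = (Num.sqrt (1 + 4 * s) - 1) / (2 * s).
Proof.
have q2 : Num.sqrt 2 ^+ 2 = 2 :> R by rewrite sqr_sqrtr.
have q0 : 0 <= Num.sqrt 2 :> R by exact: sqrtr_ge0.
have qlt : Num.sqrt 2 < 4 :> R by rewrite ltNge; apply/negP => h; nra.
rewrite /omega5 (_ : 242 + _ = (4 + Num.sqrt 2) ^+ 2 * (1 + 4 * s)); last first.
  by rewrite /s; ring: q2.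
rewrite sqrt_discr ger0_norm; last lra.
have s0 : s != 0 by rewrite /s; lra.
(* The denominator 7 is half of (4 - sqrt 2) * (4 + sqrt 2) = 14. *)
apply: (mulIf s0); rewrite invfM mulrA (mulfVK s0).
rewrite /s; set S := Num.sqrt (1 + 4 * _).
transitivity ((16 - Num.sqrt 2 ^+ 2) * (S - 1) / 28); first by field.
by rewrite q2; field.
Qed.

(** Write [r, s = 2 - nu -+ gamma nu].  For [w <= 1] the factor with [s] is
    positive above the lower endpoint, and the factor with [r] is negative:
    automatically when [2 nu^2 <= 1], as then [r <= 0], and below the upper
    endpoint otherwise.  Parameters beyond 1 occur only when [2 nu^2 < 1], and
    there the factor with [2 + nu - zeta nu] is the negative one. *)
Lemma omega_range (R : realType) (nu w : R) :
  [\/ (0 < nu /\ nu < Num.sqrt 2 / 2) /\ (omega1 nu < w /\ w < omega2 nu),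
      (Num.sqrt 2 / 2 < nu /\ nu < 1) /\ (omega3 nu < w /\ w < omega4 nu)
    | nu = Num.sqrt 2 / 2 /\ (omega5 R < w /\ w < omega6 R)] ->
  [/\ 0 < nu < 1, 0 < w < 2 & sor_poly nu w < 0].
Proof.
set q := Num.sqrt 2.
have q2 : q ^+ 2 = 2 by rewrite sqr_sqrtr.
have q0 : 0 < q by rewrite sqrtr_gt0.
have qlt : q < 2 by rewrite ltNge; apply/negP => h; nra.
case=> [[[nu0 nuq] [lw wu]]|[[nuq nu1] [lw wu]]|[nuE [lw wu]]].
- have nu01 : 0 < nu < 1 by lra.
  have be0 : beta nu < 0 by rewrite /beta; nra.
  have s0 := gamma_root_gt0 nu01; have s0' := zeta_root_gt0 nu01.
  have r0 : 2 - nu - gamma nu < 0.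
    by rewrite -(pmulr_llt0 _ s0) gamma_roots_mul.
  have r0' : 2 + nu - zeta nu < 0.
    by rewrite -(pmulr_llt0 _ s0') zeta_roots_mul.
  rewrite omega1E // in lw; rewrite omega2E // in wu.
  have [w0 fs] := quad_gt0_pos s0 lw.
  have [fr' w2] := quad_lt0_neg r0' wu.
  have w20 : 0 < w ^+ 2 by rewrite exprn_gt0.
  split => //; first by rewrite w0.
  have [w1|w1] := leP w 1.
    rewrite sor_poly_le1 // pmulr_llt0 //.
    have : (2 - nu - gamma nu) * w ^+ 2 < 0 by rewrite pmulr_llt0.
    lra.
  rewrite sor_poly_ge1 ?ltW // pmulr_llt0 //.
  have : 0 < (2 + nu + zeta nu) * w ^+ 2 by rewrite mulr_gt0.
  lra.
- have nu01 : 0 < nu < 1 by lra.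
  have be0 : 0 < beta nu by rewrite /beta; nra.
  have s0 := gamma_root_gt0 nu01.
  have r0 : 0 < 2 - nu - gamma nu.
    by rewrite -(pmulr_lgt0 _ s0) gamma_roots_mul.
  rewrite omega3E // in lw; rewrite omega4E // in wu.
  have [w0 fs] := quad_gt0_pos s0 lw.
  have fr := quad_lt0_pos r0 w0 wu.
  have rw : 0 < (2 - nu - gamma nu) * w ^+ 2 by rewrite mulr_gt0 ?exprn_gt0.
  split => //; first lra.
  by rewrite sor_poly_le1 ?pmulr_llt0 //; lra.
- have nu01 : 0 < nu < 1 by lra.
  have be0 : beta nu = 0 by rewrite /beta nuE expr_div_n q2; field.
  have s0 := gamma_root_gt0 nu01.
  have r0 : 2 - nu - gamma nu = 0.
    by apply/(mulIf (lt0r_neq0 s0)); rewrite gamma_roots_mul // mul0r.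
  have gE : gamma nu = 2 - nu by lra.
  have sE : 2 - nu + gamma nu = 4 - q by rewrite gE nuE; field.
  rewrite omega5E -sE in lw; rewrite /omega6 in wu.
  have [w0 fs] := quad_gt0_pos s0 lw.
  split => //; first lra.
  by rewrite sor_poly_le1 ?ltW // pmulr_llt0 // r0; lra.
Qed.

(** * The norm of the transfer matrix *)

Definition col2 (R : realType) (p q : R) : 'cV[R]_(1 + 1) :=
  col_mx (p%:M : 'M[R]_1) (q%:M : 'M[R]_1).

Lemma col2P (R : realType) (v : 'cV[R]_2) : exists p q, v = col2 p q.
Proof.
exists (usubmx (v : 'cV[R]_(1 + 1)) 0 0), (dsubmx (v : 'cV[R]_(1 + 1)) 0 0).
by rewrite /col2 -!mx11_scalar vsubmxK.
Qed.

Lemma norm2_col2 (R : realType) (p q : R) :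
  norm2 (col2 p q) = Num.sqrt (p ^+ 2 + q ^+ 2).
Proof.
rewrite /norm2 (@big_split_ord _ _ _ 1 1) /= !big_ord1 /col2.
by rewrite col_mxEu col_mxEd !mxE eqxx !mulr1n.
Qed.

Lemma T_mx_col2 (R : realType) (nu w p q : R)
    (a := `|1 - w|) (c := w ^+ 2 * nu) :
  (T_mx nu w : 'M[R]_(1 + 1)) *m col2 p q =
  col2 (a * p + c * q) (a * p + (a + c) * q).
Proof.
rewrite /T_mx /col2 mul_block_col.
by rewrite -!scalar_mxM -!raddfD.
Qed.

(** Completing the square needs [m1 != 0]; when [m1 = 0] the hypothesis on the
    discriminant kills the cross term. *)
Lemma quadform_ge0 (R : realType) (m1 m2 g x y : R) :
  0 <= m1 -> 0 <= m2 -> g ^+ 2 <= m1 * m2 ->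
  0 <= m1 * x ^+ 2 - 2 * g * (x * y) + m2 * y ^+ 2.
Proof.
move=> m10 m20 gm.
have [m1E|m1N] := eqVneq m1 0.
  have g0 : g = 0.
    by apply/eqP; rewrite -sqrf_eq0 eq_le sqr_ge0 -(mul0r m2) -m1E gm.
  by rewrite m1E g0 mulr0 !mul0r subr0 add0r mulr_ge0 ?sqr_ge0.
have m1p : 0 < m1 by rewrite lt0r m1N.
rewrite -(pmulr_rge0 _ m1p).
have -> : m1 * (m1 * x ^+ 2 - 2 * g * (x * y) + m2 * y ^+ 2)
  = (m1 * x - g * y) ^+ 2 + (m1 * m2 - g ^+ 2) * y ^+ 2 by ring.
by rewrite addr_ge0 ?sqr_ge0 // mulr_ge0 ?sqr_ge0 // subr_ge0.
Qed.

(** The number [t], the midpoint of 1 and [tau - delta] for [tau] the trace and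
    [delta] the determinant of [T^T * T], is an explicit bound below 1 for both
    eigenvalues of [T^T * T]: the characteristic polynomial at [t] equals
    [(1 - t)^2 + tau * (1 - t) >= 0], and [t >= tau / 2] puts [t] to the right
    of the larger root.  Hence [t - T^T * T] is positive semidefinite, with
    entries [m1], [- g], [m2], and the norm of [T] is at most [sqrt t < 1]. *)
Lemma T_mx_norm_lt1 (R : realType) (nu w : R) :
  0 < w < 2 -> sor_poly nu w < 0 -> spectral_norm (T_mx nu w) < 1.
Proof.
move=> w02; rewrite /sor_poly.
rewrite distrC; set c := w ^+ 2 * nu; set a := `|1 - w|.
have a2 : (w - 1) ^+ 2 = a ^+ 2 by rewrite real_normK ?num_real //; ring.
have a0 : 0 <= a by exact: normr_ge0.
have a1 : a < 1 by rewrite /a ltr_norml; lra.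
rewrite (_ : (w - 1) ^+ 4 = ((w - 1) ^+ 2) ^+ 2); last by rewrite -exprM.
rewrite a2 => f0.
pose tau := 3 * a ^+ 2 + 2 * a * c + 2 * c ^+ 2.
pose t := (1 + tau - a ^+ 4) / 2.
have {}f0 : tau - a ^+ 4 < 1.
  suff -> : tau - a ^+ 4 = 3 * a ^+ 2 + 2 * nu ^+ 2 * w ^+ 4
      + 2 * nu * w ^+ 2 * a - (a ^+ 2) ^+ 2 by lra.
  by rewrite /tau /c; ring.
have tau0 : 0 <= tau.
  rewrite (_ : tau = 2 * a ^+ 2 + (a + c) ^+ 2 + c ^+ 2); last first.
    by rewrite /tau; ring.
  have := sqr_ge0 a; have := sqr_ge0 c; have := sqr_ge0 (a + c); lra.
have a4 : a ^+ 4 <= 1 by rewrite exprn_ile1 // ltW.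
have t1 : t < 1 by rewrite /t; lra.
have tt : tau / 2 <= t by rewrite /t; lra.
have t0 : 0 <= t by lra.
pose m1 := t - 2 * a ^+ 2.
pose m2 := t - c ^+ 2 - (a + c) ^+ 2.
pose g := a * c + a * (a + c).
have mm : g ^+ 2 <= m1 * m2.
  have -> : m1 * m2 = g ^+ 2 + (t ^+ 2 - tau * t + a ^+ 4).
    by rewrite /m1 /m2 /g /tau; ring.
  have -> : t ^+ 2 - tau * t + a ^+ 4
      = (1 - t) ^+ 2 + tau * (1 - t) by rewrite /t; field.
  by rewrite lerDl addr_ge0 ?sqr_ge0 // mulr_ge0 //; lra.
have mge : 0 <= m1 + m2 by rewrite /m1 /m2; move: tt; rewrite /tau; lra.
have [m10 m20] : 0 <= m1 /\ 0 <= m2.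
  have mm0 : 0 <= m1 * m2 by apply: le_trans mm; rewrite sqr_ge0.
  by split; rewrite leNgt; apply/negP => h; nra.
apply: (@le_lt_trans _ _ (Num.sqrt t)); last first.
  by rewrite -[X in _ < X]sqrtr1 ltr_sqrt.
apply: spectral_norm_le => [|v]; first exact: sqrtr_ge0.
have [p [q ->]] := col2P v.
rewrite T_mx_col2 !norm2_col2 -/a -/c -sqrtrM // ler_sqrt; last first.
  by rewrite mulr_ge0 // addr_ge0 ?sqr_ge0.
rewrite -subr_ge0.
apply: le_trans (quadform_ge0 p q m10 m20 mm) _.
rewrite le_eqVlt; apply/orP; left; apply/eqP.
by rewrite /m1 /m2 /g; ring.
Qed.

(** * Solving the absolute value equation *)

(** A solution of [A x - |x| - b = 0] is a fixed point of this map for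
    [B = A^-1]. *)
Definition ave_map (R : realType) (n : nat) (B : 'M[R]_n) (b : 'cV[R]_n)
    (v : 'cV[R]_n) : 'cV[R]_n :=
  B *m (absv v + b).

Lemma ave_map_lipschitz (R : realType) (n : nat) (B : 'M[R]_n)
    (b u v : 'cV[R]_n) :
  norm2 (ave_map B b u - ave_map B b v) <= spectral_norm B * norm2 (u - v).
Proof.
rewrite -mulmxBr opprD addrACA subrr addr0.
apply: le_trans (norm2_mulmx _ _) _.
by rewrite ler_wpM2l ?spectral_norm_ge0 ?norm2_absvB.
Qed.

Lemma AVE_solutionP (R : realType) (n : nat) (A : 'M[R]_n) (b v : 'cV[R]_n) :
  A \in unitmx -> AVE_solution A b v <-> v = ave_map (invmx A) b v.
Proof.
move=> Au; rewrite /AVE_solution /ave_map; split=> [/eqP|vE].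
  by rewrite subr_eq add0r subr_eq addrC => /eqP <-; rewrite mulKmx.
by rewrite {1}vE mulKVmx // addrAC addrK subrr.
Qed.

(** Completeness of ['cV[R]_n] comes with the maximum norm, which [g] need not
    contract.  A high enough iterate of [g] contracts it, since the two norms
    are equivalent; [g] maps the fixed point of the iterate to another one,
    hence fixes it. *)
Lemma norm2_fixpoint (R : realType) (n : nat) (g : 'cV[R]_n -> 'cV[R]_n)
    (q : R) :
  0 <= q < 1 -> (forall u v, norm2 (g u - g v) <= q * norm2 (u - v)) ->
  exists p, p = g p.
Proof.
move=> /andP[q0 q1] gq.
have gk k u v : norm2 (iter k g u - iter k g v) <= q ^+ k * norm2 (u - v).
  elim: k => [|k IH]; first by rewrite expr0 mul1r.
  rewrite !iterS exprS -mulrA; apply: le_trans (gq _ _) _.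
  by rewrite ler_wpM2l.
(* The 1 makes q ^+ k < 1 even when n = 0. *)
have [k kq] : exists k, q ^+ k * (1 + Num.sqrt n%:R) < 1.
  have s0 : 0 < 1 + Num.sqrt n%:R :> R by rewrite ltr_wpDr ?sqrtr_ge0.
  have /cvgrPdist_lt /(_ (1 + Num.sqrt n%:R)^-1) : q ^+ k @[k --> \oo] --> 0.
    by apply: cvg_expr; rewrite ger0_norm.
  rewrite invr_gt0 => /(_ s0) [k _ /(_ k (leqnn k))] /=.
  rewrite sub0r normrN ger0_norm ?exprn_ge0 // => h.
  by exists k; rewrite -ltr_pdivlMr // div1r.
have qk0 : 0 <= q ^+ k by rewrite exprn_ge0.
have sn0 : 0 <= Num.sqrt n%:R :> R by rewrite sqrtr_ge0.
have K0 : 0 <= q ^+ k * Num.sqrt n%:R by rewrite mulr_ge0.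
(* A name for the normed space that carries its completeness. *)
pose V : completeNormedModType R := HB.pack 'cV[R]_n.
pose G : {fun [set: V] >-> [set: V]} := [fun of totalfun (iter k g : V -> V)].
have ctr : is_contraction G.
  exists (NngNum K0); split => [/=|[u v] _ /=]; first lra.
  apply: le_trans (norm_le_norm2 _) _; apply: le_trans (gk k u v) _.
  by rewrite -mulrA ler_wpM2l // norm2_le_norm.
have [|p _ pE] := banach_fixed_point ctr closedT; first by exists 0.
have {}pE : p = iter k g p by exact: pE.
exists p; apply/eqP; rewrite -subr_eq0; apply/eqP/norm2_eq0/eqP.
rewrite eq_le norm2_ge0 andbT.
have := gk k p (g p); rewrite -iterSr iterS -pE => h.
have : 0 < 1 - q ^+ k by nra.
by move=> h'; rewrite -(pmulr_rle0 _ h'); lra.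
Qed.

Lemma AVE_unique_solution (R : realType) (n : nat) (A : 'M[R]_n)
    (b : 'cV[R]_n) :
  A \in unitmx -> spectral_norm (invmx A) < 1 ->
  exists xs, unique (AVE_solution A b) xs.
Proof.
move=> Au nu1.
have nu0 := spectral_norm_ge0 (invmx A).
have lip := ave_map_lipschitz (invmx A) b.
have [|xs xsE] := norm2_fixpoint _ lip; first by rewrite nu0.
exists xs; split; first exact/AVE_solutionP.
move=> v /(AVE_solutionP _ _ Au) vE.
apply/eqP; rewrite -subr_eq0; apply/eqP/norm2_eq0/eqP.
rewrite eq_le norm2_ge0 andbT.
have := lip xs v; rewrite -xsE -vE => h.
have h' : 0 < 1 - spectral_norm (invmx A) by lra.
by rewrite -(pmulr_rle0 _ h'); lra.
Qed.

(** * The error recursion *)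

Lemma pair_norm_col2 (R : realType) (n : nat) (w : R) (u v : 'cV[R]_n) :
  pair_norm w u v = norm2 (col2 (norm2 u) (w^-1 * norm2 v)).
Proof. by rewrite norm2_col2 /pair_norm exprMn exprVn. Qed.

Lemma norm2_le_pair_norm (R : realType) (n : nat) (w : R) (u v : 'cV[R]_n) :
  norm2 u <= pair_norm w u v.
Proof.
have h : 0 <= w ^- 2 * norm2 v ^+ 2 by rewrite mulr_ge0 ?invr_ge0 ?sqr_ge0.
rewrite -[leLHS]ger0_norm ?norm2_ge0 // -sqrtr_sqr ler_sqrt ?lerDl //.
by rewrite addr_ge0 ?sqr_ge0.
Qed.

(** In the coordinates [p = |x-error|] and [q = |y-error| / w] one sweep is
    bounded entry by entry by the matrix [T].  The second row is the second
    equation of the sweep, with the bound of the first row inserted for the new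
    x-error; this is how its extra [`|1 - w|] and [w ^+ 2 * nu] arise. *)
Lemma SOR_error_step (R : realType) (n : nat) (B : 'M[R]_n)
    (b xs x x' y y' : 'cV[R]_n) (w : R) :
  0 < w -> xs = ave_map B b xs ->
  x' = (1 - w) *: x + w *: (B *m (y + b)) ->
  y' = (1 - w) *: y + w *: absv x' ->
  pair_norm w (xs - x') (absv xs - y') <=
  spectral_norm (T_mx (spectral_norm B) w) * pair_norm w (xs - x) (absv xs - y).
Proof.
move=> w0 xsE x'E y'E.
set nu := spectral_norm B; set ys := absv xs.
have nu0 : 0 <= nu by exact: spectral_norm_ge0.
have exE : xs - x' = (1 - w) *: (xs - x) + w *: (B *m (ys - y)).
  have -> : B *m (ys - y) = xs - B *m (y + b).
    by rewrite [in RHS]xsE /ave_map -mulmxBr [y + b]addrC addrKA.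
  rewrite x'E !scalerBr addrACA -opprD; congr (_ - _).
  by rewrite -scalerDl subrK scale1r.
have eyE : ys - y' = (1 - w) *: (ys - y) + w *: (absv xs - absv x').
  rewrite y'E !scalerBr addrACA -opprD; congr (_ - _).
  by rewrite -scalerDl subrK scale1r.
set p := norm2 (xs - x); set q := w^-1 * norm2 (ys - y).
have qE : norm2 (ys - y) = w * q by rewrite mulVKf // gt_eqF.
have px : norm2 (xs - x') <= `|1 - w| * p + w ^+ 2 * nu * q.
  rewrite exE; apply: le_trans (norm2D _ _) _.
  rewrite !norm2Z (gtr0_norm w0) lerD2l.
  rewrite (_ : w ^+ 2 * nu * q = w * (nu * (w * q))); last by ring.
  by rewrite ler_pM2l // -qE norm2_mulmx.
have py : w^-1 * norm2 (ys - y') <= `|1 - w| * p + (`|1 - w| + w ^+ 2 * nu) * q.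
  rewrite mulrC ler_pdivrMr // eyE; apply: le_trans (norm2D _ _) _.
  rewrite !norm2Z (gtr0_norm w0) qE.
  have : w * norm2 (absv xs - absv x') <= w * (`|1 - w| * p + w ^+ 2 * nu * q).
    by rewrite ler_pM2l // (le_trans (norm2_absvB _ _)).
  lra.
have p0 : 0 <= norm2 (xs - x') by exact: norm2_ge0.
have q0 : 0 <= w^-1 * norm2 (ys - y').
  by rewrite mulr_ge0 ?norm2_ge0 // invr_ge0 ltW.
rewrite !pair_norm_col2 -/p -/q; apply: le_trans (norm2_mulmx _ _).
rewrite T_mx_col2 !norm2_col2 ler_sqrt ?addr_ge0 ?sqr_ge0 //.
have Tp0 := le_trans p0 px; have Tq0 := le_trans q0 py.
by apply: lerD; rewrite ler_pXn2r ?nnegrE.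
Qed.

Lemma norm2_geometric_cvg (R : realType) (n : nat) (x : nat -> 'cV[R]_n)
    (xs : 'cV[R]_n) (C rho : R) :
  0 <= rho < 1 -> (forall k, norm2 (xs - x k) <= C * rho ^+ k) ->
  x @ \oo --> xs.
Proof.
move=> /andP[rho0 rho1] xC; apply/cvgrPdist_lt => e e0.
have /cvgrPdist_lt /(_ e e0) : geometric C rho k @[k --> \oo] --> 0.
  by apply: cvg_geometric; rewrite ger0_norm.
apply: filterS => k /=; rewrite sub0r normrN => h.
apply: le_lt_trans (norm_le_norm2 _) _; apply: le_lt_trans (xC k) _.
exact: le_lt_trans (ler_norm _) h.
Qed.

(** * Convergence *)

Theorem theorem2p2 (R : realType) (n : nat) (A : 'M[R]_n) (b : 'cV[R]_n)
    (nu omega : R) (x y : nat -> 'cV[R]_n)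
    (A_nonsing : A \in unitmx)
    (nuE : nu = spectral_norm (invmx A))
    (Homega :
      [\/ (0 < nu /\ nu < Num.sqrt 2 / 2) /\
          (omega1 nu < omega /\ omega < omega2 nu),
          (Num.sqrt 2 / 2 < nu /\ nu < 1) /\
          (omega3 nu < omega /\ omega < omega4 nu)
        | nu = Num.sqrt 2 / 2 /\
          (omega5 R < omega /\ omega < omega6 R)])
    (xy_SOR : SOR_like A b omega x y) :
  exists xs : 'cV[R]_n,
    [/\ unique (AVE_solution A b) xs,
        forall k : nat,
          pair_norm omega (xs - x k.+1) (absv xs - y k.+1) <=
          spectral_norm (T_mx nu omega) *
            pair_norm omega (xs - x k) (absv xs - y k),
        spectral_norm (T_mx nu omega) < 1
      & x @ \oo --> xs].
Proof.
have [nu01 w02 fw] := omega_range Homega.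
have /andP[w0 _] := w02; have /andP[_ nu1] := nu01.
have T1 : spectral_norm (T_mx nu omega) < 1 by exact: T_mx_norm_lt1.
have T0 := spectral_norm_ge0 (T_mx nu omega).
have [|xs xsU] := AVE_unique_solution b A_nonsing; first by rewrite -nuE.
have step k : pair_norm omega (xs - x k.+1) (absv xs - y k.+1) <=
    spectral_norm (T_mx nu omega) * pair_norm omega (xs - x k) (absv xs - y k).
  have [xE yE] := xy_SOR k; rewrite nuE.
  apply: SOR_error_step w0 _ xE yE.
  by case: xsU => /(AVE_solutionP _ _ A_nonsing).
have geo k : pair_norm omega (xs - x k) (absv xs - y k) <=
    spectral_norm (T_mx nu omega) ^+ k
    * pair_norm omega (xs - x 0) (absv xs - y 0).
  elim: k => [|k IH]; first by rewrite expr0 mul1r.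
  apply: le_trans (step k) _.
  by rewrite exprS -mulrA ler_wpM2l.
exists xs; split => //.
have T01 : 0 <= spectral_norm (T_mx nu omega) < 1 by rewrite T0.
apply: (norm2_geometric_cvg T01) => k.
apply: le_trans (norm2_le_pair_norm _ _ _) _.
by apply: le_trans (geo k) _; rewrite mulrC.
Qed.
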